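(* Let $(X,T)$ be a transitive system and $n\ge2$. Then the following statements are equivalent: (1) $(X,T)$ is broken $\{\mathbb{N}\}$-$n$-sensitive; (2) $(X,T)$ is broken $\mathcal{F}_{ps}$-$n$-sensitive; (3) there exists an essential $n$-sensitive tuple $(x_1,x_2,\dots,x_n)$ which is a distal tuple; (4) there exists an essential $n$-sensitive tuple which is an $\mathcal{F}_s$-recurrent point of $(X^n,T^{(n)})$; (5) there exists an essential $n$-sensitive tuple which is an $\mathcal{F}_{ps}$-recurrent point of $(X^n,T^{(n)})$.
   Context: A (topological dynamical) system $(X,T)$ is a compact metric space $X$ with metric $d$ and a continuous surjective map $T\colon X\to X$. $(X^n,T^{(n)})$ is the $n$-fold product system with $T^{(n)}=T\times\cdots\times T$. $\mathbb{Z}_+=\{0,1,2,\dots\}$, $\mathbb{N}=\{1,2,\dots\}$. ''Opene'' means non-empty open. $(X,T)$ is transitive if for all opene $U,V\subset X$ the set $\{k\in\mathbb{Z}_+: U\cap T^{-k}V\ne\emptyset\}$ is infinite. A set $A\subset\mathbb{Z}_+$ is thick if for every $l\ge1$ there is $n_l\in\mathbb{N}$ with $\{n_l,\dots,n_l+l\}\subset A$; syndetic if there is $N\in\mathbb{N}$ such that $\{k,\dots,k+N\}\cap A\ne\emptyset$ for every $k\in\mathbb{N}$; piecewise syndetic if it is the intersection of a thick set and a syndetic set. $\mathcal{F}_s$ and $\mathcal{F}_{ps}$ are the families of syndetic, respectively piecewise syndetic, subsets of $\mathbb{Z}_+$. For a collection $\mathcal{F}$ of subsets of $\mathbb{Z}_+$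 and a system $(Y,S)$, a point $y\in Y$ is $\mathcal{F}$-recurrent if $\{k\in\mathbb{Z}_+: S^ky\in U\}\in\mathcal{F}$ for every neighbourhood $U$ of $y$. For a collection $\mathcal{F}$ of subsets of $\mathbb{Z}_+$ (including the one-element collection $\{\mathbb{N}\}$), $(X,T)$ is broken $\mathcal{F}$-$n$-sensitive if there exist $\delta>0$ and $F\in\mathcal{F}$ such that for every opene $U\subset X$ and every $l\in\mathbb{N}$ there exist $x_1^l,\dots,x_n^l\in U$ and $m_l\in\mathbb{Z}_+$ with $\min_{1\le i<j\le n}d(T^kx_i^l,T^kx_j^l)>\delta$ for all $k\in m_l+(F\cap[1,l])$. A tuple $(x_1,\dots,x_n)\in X^n$ whose coordinates are not all equal is an $n$-sensitive tuple if for every opene $U\subset X$ and all open neighbourhoods $U_i$ of $x_i$ ($1\le i\le n$) there exist $y_1,\dots,y_n\in U$ and $m\in\mathbb{N}$ with $T^my_i\in U_i$ for all $i$. It is essential if moreover $x_i\ne x_j$ for all $i\ne j$. A pair $(x,y)$ is proximal if for every $\varepsilon>0$ there is a positive integer $m$ with $d(T^mx,T^my)<\varepsilon$. A tuple $(x_1,\dots,x_n)$ is a distal tuple if for all $i\ne j$ the pair $(x_i,x_j)$ is not proximal. *)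

(* Defs.v *)
From mathcomp Require Import all_boot all_order all_algebra.
From mathcomp Require Import all_classical all_reals all_analysis.

Set Implicit Arguments.
Unset Strict Implicit.
Unset Printing Implicit Defensive.

Import Order.TTheory GRing.Theory Num.Theory.

Local Open Scope classical_set_scope.
Local Open Scope ring_scope.

(** Throughout, [nat] plays the role of Z_+ = {0, 1, 2, ...} and "k in N" is
    spelled [(1 <= k)%N]; a family of subsets of Z_+ is a [set (set nat)]. *)

Definition is_system (R : realType) (X : metricType R) (T : X -> X) : Prop :=
  [/\ compact [set: X], continuous T & forall y, exists x, T x = y].

Definition opene (X : topologicalType) (U : set X) : Prop :=
  open U /\ U !=set0.

Definition transitive_map (X : topologicalType) (T : X -> X) : Prop :=
  forall U V : set X, opene U -> opene V ->
    infinite_set [set k : nat | U `&` (iter k T @^-1` V) !=set0].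

Definition thick (A : set nat) : Prop :=
  forall l : nat, (1 <= l)%N ->
    exists2 m : nat, (1 <= m)%N & forall k : nat, (m <= k <= m + l)%N -> A k.

Definition syndetic (A : set nat) : Prop :=
  exists2 N : nat, (1 <= N)%N &
    forall k : nat, (1 <= k)%N -> exists2 j : nat, (k <= j <= k + N)%N & A j.

Definition piecewise_syndetic (A : set nat) : Prop :=
  exists B C : set nat, [/\ thick B, syndetic C & A = B `&` C].

Definition family_s : set (set nat) := [set A | syndetic A].
Definition family_ps : set (set nat) := [set A | piecewise_syndetic A].
Definition family_N : set (set nat) := [set [set k : nat | (1 <= k)%N]].

Definition recurrent_pt (F : set (set nat)) (Y : topologicalType) (S : Y -> Y)
    (y : Y) : Prop :=
  forall U : set Y, nbhs y U -> F [set k : nat | U (iter k S y)].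

(** The map T x ... x T on X^n; [{ptws 'I_n -> X}] is the set of functions
    ['I_n -> X] with the product topology. *)
Definition product_map (X : topologicalType) (n : nat) (T : X -> X)
    (x : {ptws 'I_n -> X}) : {ptws 'I_n -> X} := fun i => T (x i).

(** The condition "min_{i < j} d > delta for all times in m + (F `&` [1, l])"
    is unfolded into quantifications over the pairs i < j and over the times
    m + k with k in F and 1 <= k <= l. *)
Definition broken_sensitive (R : realType) (X : metricType R) (T : X -> X)
    (n : nat) (Fam : set (set nat)) : Prop :=
  exists2 delta : R, 0 < delta &
  exists2 F : set nat, Fam F &
  forall U : set X, opene U -> forall l : nat, (1 <= l)%N ->
  exists x : 'I_n -> X, exists m : nat,
    (forall i, U (x i)) /\
    forall k : nat, F k -> (1 <= k <= l)%N ->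
    forall i j : 'I_n, (i < j)%N ->
      delta < mdist (iter (m + k) T (x i)) (iter (m + k) T (x j)).

Definition sensitive_tuple (X : topologicalType) (T : X -> X) (n : nat)
    (x : 'I_n -> X) : Prop :=
  (exists i j : 'I_n, x i <> x j) /\
  forall (U : set X) (V : 'I_n -> set X),
    opene U -> (forall i, open_nbhs (x i) (V i)) ->
    exists y : 'I_n -> X, exists m : nat,
      [/\ (1 <= m)%N, forall i, U (y i) & forall i, V i (iter m T (y i))].

Definition essential_sensitive_tuple (X : topologicalType) (T : X -> X)
    (n : nat) (x : 'I_n -> X) : Prop :=
  sensitive_tuple T x /\ forall i j : 'I_n, i <> j -> x i <> x j.

Definition proximal (R : realType) (X : metricType R) (T : X -> X)
    (x y : X) : Prop :=
  forall eps : R, 0 < eps ->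
    exists2 m : nat, (1 <= m)%N & mdist (iter m T x) (iter m T y) < eps.

Definition distal_tuple (R : realType) (X : metricType R) (T : X -> X)
    (n : nat) (x : 'I_n -> X) : Prop :=
  forall i j : 'I_n, i <> j -> ~ proximal T (x i) (x j).

(* Main.v *)
Require Import Defs.
From mathcomp Require Import all_boot all_order all_algebra.
From mathcomp Require Import all_classical all_reals all_analysis.
From mathcomp Require Import zify lra.

(** The five conditions all say that n points starting in any given opene set
    can be kept a fixed distance apart for arbitrarily long stretches of time.

    Passing between all times and a piecewise syndetic set of times costs only
    a change of constant. Such a set contains, on arbitrarily long windows, a
    set of bounded gap N, and by uniform continuity of T, ..., T^N two points
    that are d-apart at some time within the next N steps are e-apart now, for
    some e > 0 that depends only on d and N ([iter_separation_pullback]). So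
    separation along a bounded-gap subset of a window becomes separation on
    the whole window. Broken [family_ps]-sensitivity thus implies broken
    [family_N]-sensitivity, and the converse holds because the positive integers
    are themselves a piecewise syndetic set. The same argument shows that an
    essential sensitive tuple which is [family_ps]-recurrent makes the system
    broken [family_N]-sensitive: the times at which the orbit of the tuple is
    back near the tuple are separated times, and n points of any opene set can
    be sent so close to the tuple that they shadow it over a whole window.

    For a distal sensitive tuple, consider the tuples T^m y with y_1, ..., y_n
    in U, with m large and with a long separated future. Broken sensitivity
    makes this collection non-empty for every U, and transitivity makes these
    collections directed as U varies: points of the intersection of U1 with
    T^-k U2 lie in U1 now and in U2 after k steps. A cluster point in the
    compact space X^n ([broken_sensitive_attracting_tuple]) is reached from
    every opene set and stays separated forever, so it is sensitive, essential
    and distal.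

    Finally, for fixed d > 0, the tuples of X^n that are reached from every
    opene set and stay d-separated forever form a closed set, invariant under
    T x ... x T and non-empty when there is a distal sensitive tuple. It contains
    a minimal set, whose points are syndetically recurrent
    ([exists_syndetically_recurrent]); syndetic recurrence in turn implies
    piecewise syndetic recurrence. *)

Import Order.TTheory GRing.Theory Num.Theory.

Local Open Scope classical_set_scope.
Local Open Scope ring_scope.

(** * Piecewise syndetic sets *)

Lemma syndetic_piecewise (A : set nat) : syndetic A -> piecewise_syndetic A.
Proof.
move=> sA; exists setT, A; split=> //; last by rewrite setTI.
by move=> l _; exists 1%N.
Qed.

Lemma syndetic_positive : syndetic [set k : nat | (1 <= k)%N].
Proof. by exists 1%N => // k k1; exists k => //; rewrite leqnn leq_addr. Qed.

(** The form in which piecewise syndeticity is used: one gap N serves for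
    windows [a, a + l] of every length l. *)
Lemma piecewise_syndetic_gap (A : set nat) : piecewise_syndetic A ->
  exists N, forall l, exists2 a, (1 <= a)%N &
    forall k, (k <= l)%N -> exists2 j, (k <= j <= k + N)%N & A (a + j)%N.
Proof.
move=> [B [C [tB [N N1 sC] ->]]]; exists N => l.
(* The thick part must also cover the N times following the window, where the
   syndetic part may take its next element. *)
have [//|m m1 Bm] := tB (l + N)%N; first by lia.
exists m => // k kl; have [|j jk Cj] := sC (m + k)%N; first by lia.
exists (j - m)%N; first by lia.
have -> : (m + (j - m))%N = j by lia.
by split=> //; apply: Bm; lia.
Qed.

(** * Minimal sets and syndetic recurrence *)

Lemma iter_continuous (Y : topologicalType) (S : Y -> Y) (k : nat) :
  continuous S -> continuous (iter k S).
Proof.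
move=> cS; elim: k => [|k IHk] y; first exact: cvg_id.
exact: (continuous_comp (IHk y) (cS _)).
Qed.

(** When C is invariant, C \ W is minimal among the non-empty invariant subsets
    of C that are relatively closed in C; working with open complements lets
    Zorn's lemma apply to unions of chains. A chain of open sets none of which
    covers the compact set C does not cover C either, because one member of the
    chain would absorb a finite subcover. *)
Lemma maximal_invariant_open (Y : topologicalType) (S : Y -> Y) (C : set Y) :
  compact C -> C !=set0 ->
  exists2 W : set Y, [/\ open W, S @^-1` W `<=` W & ~ (C `<=` W)] &
    forall W' : set Y, open W' -> S @^-1` W' `<=` W' -> W `<=` W' ->
      ~ (C `<=` W') -> W' `<=` W.
Proof.
move=> cC [c Cc].
pose P (W : set Y) := [/\ open W, S @^-1` W `<=` W & ~ (C `<=` W)].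
have [F FP Ftot|W [PW maxW]] := @Zorn_bigcup Y P; last first.
  exists W => // W2 oW iW WW2 nW; apply: contrapT => nW2W.
  by apply: (maxW W2).
split.
- by apply: bigcup_open => W /FP[].
- by move=> y [W FW SO]; exists W => //; have [_ + _] := FP W FW; apply.
move=> CF; have [W0 FW0 _] := CF _ Cc.
pose G := filter_from F (fun W => [set W' | F W' /\ W `<=` W']).
have FG : Filter G.
  apply: filter_from_filter; first by exists W0.
  move=> W1 W2 F1 F2; have [W12|W21] := Ftot _ _ F1 F2.
    exists W2 => // W [FW W2W]; split; split=> //.
    exact: subset_trans W2W.
  exists W1 => // W [FW W1W]; split; split=> //.
  exact: subset_trans W1W.
have [W FW CW] : G [set W | C `<=` W].
  apply: ((compact_near_coveringP C).1 cC _ G (fun W y => W y)) => y Cy.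
  have [W FW Wy] := CF _ Cy; exists (W, [set W' | F W' /\ W `<=` W']).
    split; last by exists W.
    by apply: open_nbhs_nbhs; split=> //; have [] := FP W FW.
  by move=> [z W'] /= [Wz [_ WW']]; apply: WW'.
by have [_ _ []] := FP W FW; exact: (CW W (conj FW (@subset_refl _ W))).
Qed.

(** Let z lie in a minimal set M = C \ W and let V be an open neighbourhood of
    z. The orbit of each point of M enters V, since the points of M whose orbits
    avoid V form an invariant set, closed in C, that misses z. By compactness of
    C the orbit enters V within a bounded time N. This applies to each point of
    the orbit of z, so N bounds the gaps between returns of z to V. *)
Lemma exists_syndetically_recurrent (Y : topologicalType) (S : Y -> Y)
    (C : set Y) :
  continuous S -> compact C -> C !=set0 ->
  (forall y, C y -> C (S y)) -> exists2 y, C y & recurrent_pt family_s S y.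
Proof.
move=> cS cC C0 SC.
have [W [oW iW /existsNP[z /not_implyP[Cz nWz]]] maxW] :=
  maximal_invariant_open Y S C cC C0.
exists z => // U; rewrite nbhsE => -[V [oV Vz] VU].
pose W' := W `|` [set y | exists k, V (iter k S y)].
have CW' : C `<=` W'.
  apply: contrapT => nCW'; apply: nWz; apply: (maxW W') => //.
  - have -> : W' = W `|` \bigcup_k (iter k S @^-1` V).
      apply/seteqP; split=> y /= [|[k]].
      + by left.
      + by right; exists k.
      + by left.
      + by right; exists k.
    apply: openU => //; apply: bigcup_open => k _.
    by apply: open_comp => // y _; exact: iter_continuous.
  - move=> y [/iW|[k]]; first by left.
    by rewrite -iterSr => Vk; right; exists k.+1.
  - by move=> y Wy; left.
  - by right; exists 0%N.
have [N _ CN] : \forall N \near \oo,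
    C `<=` [set y | W y \/ exists2 k, (k <= N)%N & V (iter k S y)].
  have /compact_near_coveringP/(_ _ \oo
    (fun N y => W y \/ exists2 k, (k <= N)%N & V (iter k S y)) _) := cC.
  apply=> y /CW'[Wy|[k Vk]].
    exists (W, setT) => [|[y' N] [/= Wy' _]]; last by left.
    by split; [exact: open_nbhs_nbhs|exact: filterT].
  exists (iter k S @^-1` V, [set N | (k <= N)%N]).
    split; last exact: nbhs_infty_ge.
    by apply: iter_continuous => //; apply: open_nbhs_nbhs.
  by move=> [y' N] [/= Vk' kN]; right; exists k.
have Ck k : C (iter k S z) by elim: k => //= k /SC.
have nWk k : ~ W (iter k S z) by elim: k => //= k + /iW.
exists N.+1 => // k _; have /= [Wk|[j jN]] := CN N (leqnn N) _ (Ck k).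
  by case: (nWk k).
rewrite /= -iterD => Vjk; exists (j + k)%N; first by lia.
exact: VU.
Qed.

(** * Separation of two orbits *)

Section Separation.
Context {R : realType} {X : metricType R}.

Lemma mdist_perturb (x y x' y' : X) :
  mdist x y <= mdist x' y' + mdist x x' + mdist y y'.
Proof.
have := metric_triangle x x' y; have := metric_triangle x' y' y.
rewrite (metric_sym y' y); lra.
Qed.

(** The Bowen balls of T are neighbourhoods of their centre. *)
Lemma near_iter_mdist_lt (T : X -> X) (x : X) (m : nat) (e : R) :
  continuous T -> 0 < e ->
  \forall z \near x, forall k, (k <= m)%N -> mdist (iter k T x) (iter k T z) < e.
Proof.
move=> cT e0.
have near_k k : \forall z \near x, mdist (iter k T x) (iter k T z) < e.
  have /metricType_numDomainType.cvgrPdist_lt := iter_continuous X T k cT x.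
  by apply.
have : \forall z \near x, forall k : 'I_m.+1, mdist (iter k T x) (iter k T z) < e.
  by apply: filter_forall => k; exact: near_k.
by apply: filterS => z zm k km; exact: (zm (Ordinal (km : (k < m.+1)%N))).
Qed.

(** Uniform equicontinuity of T^0, ..., T^N, read contrapositively: a later
    separation forces a present one. *)
Lemma iter_separation_pullback (T : X -> X) (N : nat) (d : R) :
  compact [set: X] -> continuous T -> 0 < d ->
  exists2 e : R, 0 < e & forall x y j, (j <= N)%N ->
    d < mdist (iter j T x) (iter j T y) -> e < mdist x y.
Proof.
move=> cX cT d0.
have : \forall e \near 0^'+, [set: X] `<=`
    [set x | forall y, mdist x y <= e -> forall j, (j <= N)%N ->
      mdist (iter j T x) (iter j T y) <= d].
  have /compact_near_coveringP/(_ _ (0 : R)^'+ (fun e x =>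
    forall y, mdist x y <= e -> forall j, (j <= N)%N ->
      mdist (iter j T x) (iter j T y) <= d) _) := cX.
  apply=> x _; have d20 : 0 < d / 2 by lra.
  have /metricType_numDomainType.nbhs_mdistP[r /= r0 xr] :=
    near_iter_mdist_lt T x N (d / 2) cT d20.
  exists ([set z | mdist x z < r / 2], [set e | e < r / 2]).
    split; last by apply: nbhs_right_lt; lra.
    apply/metricType_numDomainType.nbhs_mdistP.
    by exists (r / 2) => //=; lra.
  move=> [z e] /= [xz er] y zy j jN.
  have xy : mdist x y < r by have := metric_triangle x z y; lra.
  have {}xz : mdist x z < r by lra.
  have := xr _ xz _ jN; have := xr _ xy _ jN.
  have := metric_triangle (iter j T z) (iter j T x) (iter j T y).
  by rewrite (metric_sym (iter j T z) (iter j T x)); lra.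
move=> near_e; near (0 : R)^'+ => e.
exists e; first by near: e; exact: nbhs_right_gt.
move=> x y j jN dj; rewrite ltNge; apply/negP => xy.
have eP : [set: X] `<=`
    [set x | forall y, mdist x y <= e -> forall j, (j <= N)%N ->
      mdist (iter j T x) (iter j T y) <= d] by near: e.
by have := eP x I y xy j jN; lra.
Unshelve. all: by end_near. Qed.

End Separation.

(** * Sensitive tuples *)

Section Tuples.
Context {R : realType} {X : metricType R} (T : X -> X) (n : nat).

(** Sensitivity of a tuple without the requirement that its coordinates are not
    all equal. The diagonal is kept so that the condition is closed and
    invariant. *)
Definition reached_from_everywhere (x : {ptws 'I_n -> X}) : Prop :=
  forall (U : set X) (V : 'I_n -> set X),
    opene U -> (forall i, open_nbhs (x i) (V i)) ->
    exists y : 'I_n -> X, exists m : nat,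
      [/\ (1 <= m)%N, forall i, U (y i) & forall i, V i (iter m T (y i))].

(** The non-strict inequality makes this a closed condition. *)
Definition separated_until (d : R) (q : nat) (x : {ptws 'I_n -> X}) : Prop :=
  forall k, (k <= q)%N -> forall i j : 'I_n, i <> j ->
    d <= mdist (iter k T (x i)) (iter k T (x j)).

Definition separated_forever (d : R) (x : {ptws 'I_n -> X}) : Prop :=
  forall q, separated_until d q x.

Lemma near_box (x : {ptws 'I_n -> X}) (V : 'I_n -> set X) :
  (forall i, nbhs (x i) (V i)) -> \forall z \near x, forall i, V i (z i).
Proof.
move=> xV.
pose W i := [set z : {ptws 'I_n -> X} | V i (z i)].
apply: (@filter_forall _ 'I_n W (nbhs x) (nbhs_filter x)) => i.
exact: (@proj_continuous 'I_n (fun=> X) i x _ (xV i)).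
Qed.

Lemma compact_power : compact [set: X] -> compact [set: {ptws 'I_n -> X}].
Proof.
move=> cX; have := @tychonoff 'I_n (fun=> X) (fun=> setT) (fun=> cX).
by congr (compact _); apply/seteqP; split.
Qed.

Lemma product_map_continuous : continuous T -> continuous (@product_map X n T).
Proof.
move=> cT x.
have Fx := fmap_filter (@product_map X n T) (nbhs_filter x).
apply/cvg_sup => i W [_ [[V oV <-] /= Vx] VW].
apply: filterS VW _.
apply: (@proj_continuous 'I_n (fun=> X) i x (T @^-1` V)).
by apply: cT; exact: open_nbhs_nbhs.
Qed.

Lemma iter_product_map (k : nat) (x : {ptws 'I_n -> X}) (i : 'I_n) :
  iter k (product_map T) x i = iter k T (x i).
Proof. by elim: k x => //= k IHk x; rewrite /product_map IHk. Qed.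

Lemma closed_separated_until (d : R) (q : nat) :
  continuous T -> closed (separated_until d q).
Proof.
move=> cT x clx k kq i j ij; apply/ler_addgt0Pr => e e0.
have e2 : 0 < e / 2 by lra.
have [z [sz xz]] := clx _ (near_box x _
  (fun i => near_iter_mdist_lt T (x i) q (e / 2) cT e2)).
have := sz k kq i j ij.
have := mdist_perturb (iter k T (z i)) (iter k T (z j))
  (iter k T (x i)) (iter k T (x j)).
have := xz i k kq; have := xz j k kq.
rewrite (metric_sym (iter k T (z i)) (iter k T (x i))).
by rewrite (metric_sym (iter k T (z j)) (iter k T (x j))); lra.
Qed.

Lemma mdist_ltn_sym (d : R) (x : 'I_n -> X) :
  (forall i j : 'I_n, (i < j)%N -> d < mdist (x i) (x j)) ->
  forall i j : 'I_n, i <> j -> d < mdist (x i) (x j).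
Proof.
move=> dx i j ij; have [|/dx|/ord_inj//] := ltngtP i j; first exact: dx.
by rewrite metric_sym.
Qed.

Lemma essential_sensitive_separated (d : R) (x : {ptws 'I_n -> X}) :
  (2 <= n)%N -> 0 < d -> reached_from_everywhere x -> separated_forever d x ->
  essential_sensitive_tuple T x.
Proof.
move=> n2 d0 rx sx.
have x_neq i j : i <> j -> x i <> x j.
  move=> ij xij; have /= := sx 0%N 0%N isT i j ij.
  by rewrite xij mdistxx leNgt d0.
split=> //; split=> //.
have n0 : (0 < n)%N by exact: ltnW.
by exists (Ordinal n0), (Ordinal n2); apply: x_neq => /(congr1 val).
Qed.

(** The pair (U, q) indexes the tuples T^m y with y in U^n, m > q and separation
    at the times 0, ..., q. One parameter q bounds both the time already
    elapsed and the separated future, since moving the starting point k steps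
    along its orbit uses up k units of elapsed time. *)
Lemma broken_sensitive_attracting_tuple :
  [set: X] !=set0 -> compact [set: X] -> continuous T -> transitive_map T ->
  broken_sensitive T n family_N ->
  exists2 d : R, 0 < d &
    exists2 x, reached_from_everywhere x & separated_forever d x.
Proof.
move=> [x0 _] cX cT trT [d d0 [_ -> brokenT]].
pose A (t : set X * nat) : set {ptws 'I_n -> X} := [set z |
  exists y : 'I_n -> X, exists m : nat, [/\ (t.2 < m)%N, forall i, t.1 (y i),
    z = (fun i => iter m T (y i)) & separated_until d t.2 z]].
pose D := [set t : set X * nat | opene t.1].
have FA : ProperFilter (filter_from D A).
  apply: filter_from_proper; last first.
    (* The first q + 1 separated times are spent on reaching a time m > q; the
       next q + 1 provide the separated future. *)
    move=> [U q] oU; have [|y [m [Uy sep]]] := brokenT U oU (2 * q + 2)%N.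
      by lia.
    exists (fun i => iter (m + q.+1) T (y i)), y, (m + q.+1)%N; split=> //=.
      by lia.
    move=> k kq i j ij; rewrite -!iterD ltW//.
    have -> : (k + (m + q.+1) = m + (q.+1 + k))%N by lia.
    apply: (mdist_ltn_sym d (fun i => iter (m + (q.+1 + k)) T (y i)) _ i j ij).
    by apply: sep => /=; lia.
  apply: filter_from_filter.
    exists (setT, 0%N); split; [exact: openT|by exists x0].
  move=> [U1 q1] [U2 q2] oU1 oU2.
  have [k Uk] : exists k, U1 `&` (iter k T @^-1` U2) !=set0.
    by have /infinite_setN0[k] := trT U1 U2 oU1 oU2; exists k.
  (* The extra k in the index leaves a tuple starting in U2 with elapsed time
     m - k > q2. *)
  exists (U1 `&` (iter k T @^-1` U2), maxn q1 q2 + k)%N.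
    split=> //; apply: openI; first by case: oU1.
    by apply: open_comp; [move=> y _; exact: iter_continuous|case: oU2].
  move=> z [y [m [/= qm Uy zE sz]]]; split.
  - exists y, m; split=> //=; [by lia|by move=> i; have [] := Uy i|].
    by move=> p pq; apply: sz; lia.
  - exists (fun i => iter k T (y i)), (m - k)%N; split=> /=; [by lia| | |].
    + by move=> i; have [] := Uy i.
    + by rewrite zE; apply/funext => i; rewrite -iterD subnK//; lia.
    + by move=> p pq; apply: sz; lia.
have [x [_ clx]] := compact_power cX _ FA filterT.
exists d => //; exists x.
- move=> U V oU xV.
  have AU : filter_from D A (A (U, 0%N)) by exists (U, 0%N).
  have [z [[y [m [m0 Uy -> _]]] Vz]] :=
    clx _ _ AU (near_box x V (fun i => open_nbhs_nbhs (xV i))).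
  by exists y, m.
- move=> q; apply: (closed_separated_until d q cT) => B xB.
  have AU : filter_from D A (A (setT, q)).
    by exists (setT, q) => //; split; [exact: openT|exists x0].
  by have [z [[y [m [_ _ _ sz]]] Bz]] := clx _ _ AU xB; exists z.
Qed.

(** Over a window [a, a + l] on which F has gap N, separation at the times of F
    is pulled back to every time of the window; the window then plays the role
    of [1, l]. *)
Lemma broken_piecewise_syndetic :
  compact [set: X] -> continuous T ->
  broken_sensitive T n family_ps -> broken_sensitive T n family_N.
Proof.
move=> cX cT [d d0 [F /piecewise_syndetic_gap[N gapF] brokenT]].
have [e e0 pull] := iter_separation_pullback T N d cX cT d0.
exists e => //; exists [set k | (1 <= k)%N] => // U oU l l1.
have [a a1 Fa] := gapF l.
have [|x [m [Ux sep]]] := brokenT U oU (a + l + N)%N; first by lia.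
exists x, (m + a)%N; split=> // k _ /andP[k1 kl] i j ij.
have [p kp Fp] := Fa k kl.
apply: (pull _ _ (p - k)%N); first by lia.
rewrite -!iterD.
have -> : (p - k + (m + a + k) = m + (a + p))%N by lia.
by apply: sep => //; lia.
Qed.

Lemma closed_reached_separated (d : R) :
  continuous T ->
  closed [set x | reached_from_everywhere x /\ separated_forever d x].
Proof.
move=> cT x clx; split.
- move=> U V oU xV.
  have [z [[rz _] Vz]] := clx _ (near_box x V (fun i => open_nbhs_nbhs (xV i))).
  by apply: rz => // i; split; [case: (xV i)|exact: Vz].
- move=> q; apply: (closed_separated_until d q cT) => B xB.
  by have [z [[_ sz] Bz]] := clx B xB; exists z.
Qed.

Lemma reached_product_map (x : {ptws 'I_n -> X}) :
  continuous T -> reached_from_everywhere x ->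
  reached_from_everywhere (product_map T x).
Proof.
move=> cT rx U V oU TxV.
have [|y [m [m1 Uy Vy]]] := rx U (fun i => T @^-1` V i) oU.
  move=> i; have [oV Vx] := TxV i; split=> //.
  by apply: open_comp => // y _; exact: cT.
by exists y, m.+1.
Qed.

Lemma separated_product_map (d : R) (x : {ptws 'I_n -> X}) :
  separated_forever d x -> separated_forever d (product_map T x).
Proof. by move=> sx q k kq i j ij; rewrite -!iterSr; exact: (sx k.+1). Qed.

(** Non-proximality bounds the distances at positive times only, hence the
    shift to the image tuple. *)
Lemma distal_tuple_gap (x : 'I_n -> X) : distal_tuple T x ->
  exists2 d : R, 0 < d & separated_forever d (product_map T x).
Proof.
move=> distx; have : \forall d \near 0^'+, separated_forever d (product_map T x).
  suff : \forall d \near 0^'+, forall i j : 'I_n, i <> j -> forall k,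
      d <= mdist (iter k T (T (x i))) (iter k T (T (x j))).
    by apply: filterS => d dx q k _ i j ij; exact: dx.
  apply: filter_forall => i; apply: filter_forall => j.
  have [->|/eqP ij] := eqVneq i j; first by apply: nearW => d.
  have /existsNP[e /not_implyP[e0 ne]] := distx i j ij.
  apply: filterS (nbhs_right_lt e0) => d de _ k; rewrite leNgt; apply/negP => kd.
  by apply: ne; exists k.+1 => //; rewrite !iterSr (lt_trans kd).
move=> near_d; near (0 : R)^'+ => d; exists d; last by near: d.
by near: d; exact: nbhs_right_gt.
Unshelve. all: by end_near. Qed.

Lemma essential_tuple_gap (x : 'I_n -> X) :
  (forall i j : 'I_n, i <> j -> x i <> x j) ->
  exists2 d : R, 0 < d & forall i j : 'I_n, i <> j -> d < mdist (x i) (x j).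
Proof.
move=> x_neq.
have near_d : \forall d \near (0 : R)^'+, forall i j : 'I_n, i <> j ->
    d < mdist (x i) (x j).
  apply: filter_forall => i; apply: filter_forall => j.
  have [->|/eqP ij] := eqVneq i j; first by apply: nearW => d.
  have dij : 0 < mdist (x i) (x j) by rewrite mdist_gt0; apply/eqP; exact: x_neq.
  by apply: filterS (nbhs_right_lt dij) => d dx _.
near (0 : R)^'+ => d; exists d; last by near: d.
by near: d; exact: nbhs_right_gt.
Unshelve. all: by end_near. Qed.

(** Returns of the tuple x near itself are times of separation d / 2, so on
    suitable windows x is e-separated at every time, with e independent of the
    window. Points of U that are sent into the Bowen balls of radius e / 4
    around the coordinates of x stay e / 2-separated over the window. *)
Lemma recurrent_essential_broken (x : {ptws 'I_n -> X}) :
  compact [set: X] -> continuous T ->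
  essential_sensitive_tuple T x ->
  recurrent_pt family_ps (product_map T) x -> broken_sensitive T n family_N.
Proof.
move=> cX cT [[_ rx] x_neq] recx.
have [d d0 dx] := essential_tuple_gap x x_neq.
have d4 : 0 < d / 4 by lra.
have d2 : 0 < d / 2 by lra.
(* The Bowen ball of time 0 is the usual ball. *)
have /recx/piecewise_syndetic_gap[N gapx] :=
  near_box x _ (fun i => near_iter_mdist_lt T (x i) 0 (d / 4) cT d4).
have [e e0 pull] := iter_separation_pullback T N (d / 2) cX cT d2.
exists (e / 2); first by lra.
exists [set k | (1 <= k)%N] => // U oU l l1.
have [a _ xa] := gapx l.
have sepx k : (k <= l)%N -> forall i j : 'I_n, i <> j ->
    e < mdist (iter (a + k) T (x i)) (iter (a + k) T (x j)).
  move=> kl i j ij; have [p kp xp] := xa k kl.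
  apply: (pull _ _ (p - k)%N); first by lia.
  rewrite -!iterD.
  have -> : (p - k + (a + k) = a + p)%N by lia.
  have := mdist_perturb (x i) (x j) (iter (a + p) T (x i)) (iter (a + p) T (x j)).
  have := dx i j ij; have /= := xp i 0%N isT; have /= := xp j 0%N isT.
  by rewrite !iter_product_map; lra.
have e4 : 0 < e / 4 by lra.
have near_x i := near_iter_mdist_lt T (x i) (a + l) (e / 4) cT e4.
have [i|y [m [_ Uy Vy]]] := rx U (fun i => interior
    [set z | forall k, (k <= a + l)%N ->
      mdist (iter k T (x i)) (iter k T z) < e / 4]) oU.
  by split; [exact: open_interior|exact: near_x].
exists y, (m + a)%N; split=> // k _ /andP[k1 kl] i j ij.
have ij' : i <> j by move=> ij0; move: ij; rewrite ij0 ltnn.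
have akl : (a + k <= a + l)%N by lia.
have := mdist_perturb (iter (a + k) T (x i)) (iter (a + k) T (x j))
  (iter (a + k) T (iter m T (y i))) (iter (a + k) T (iter m T (y j))).
have := sepx k kl i j ij'.
have := interior_subset (Vy i) _ akl; have := interior_subset (Vy j) _ akl.
rewrite -!iterD.
have -> : (a + k + m = m + a + k)%N by lia.
lra.
Qed.

End Tuples.

Theorem theorem3p3 (R : realType) (X : metricType R) (T : X -> X) (n : nat)
    (hX : [set: X] !=set0) (hT : is_system T) (htr : transitive_map T)
    (hn : (2 <= n)%N) :
  [<-> broken_sensitive T n family_N;
       broken_sensitive T n family_ps;
       exists x : 'I_n -> X, essential_sensitive_tuple T x /\ distal_tuple T x;
       exists x : {ptws 'I_n -> X}, essential_sensitive_tuple T x /\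
         recurrent_pt family_s (product_map T) x;
       exists x : {ptws 'I_n -> X}, essential_sensitive_tuple T x /\
         recurrent_pt family_ps (product_map T) x].
Proof.
have [cX cT _] := hT; tfae.
- move=> [d d0 [F -> brokenT]]; exists d => //.
  exists [set k : nat | (1 <= k)%N] => //.
  exact: syndetic_piecewise syndetic_positive.
- move=> /(broken_piecewise_syndetic T n cX cT).
  move=> /(broken_sensitive_attracting_tuple T n hX cX cT htr)[d d0 [x rx sx]].
  exists x; split; first exact: essential_sensitive_separated sx.
  move=> i j ij /(_ d d0)[m _]; rewrite ltNge => /negP; apply.
  exact: (sx m m).
- move=> [x [[[_ rx] _] distx]].
  have [d d0 sTx] := distal_tuple_gap T n x distx.
  have [||||z [rz sz] recz] := @exists_syndetically_recurrent _
      (@product_map X n T)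
      [set z | reached_from_everywhere T n z /\ separated_forever T n d z].
  + exact: product_map_continuous.
  + apply: (subclosed_compact _ (compact_power n cX)) => //.
    exact: closed_reached_separated.
  + by exists (product_map T x); split=> //; exact: reached_product_map.
  + move=> z [rz sz]; split; first exact: reached_product_map.
    exact: separated_product_map.
  + by exists z; split=> //; exact: essential_sensitive_separated sz.
- move=> [x [ex recx]]; exists x; split=> // U /recx.
  exact: syndetic_piecewise.
- by move=> [x [ex recx]]; exact: recurrent_essential_broken recx.
Qed.
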